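(* There is a constant $c>0$ such that for every integer $n\ge 1$, with $N=2^n$, the $2N\times 2N$ unitary matrix $C_N^{\mathrm{IV}}\oplus (-i)\,S_N^{\mathrm{IV}}$ can be realized exactly by a quantum circuit on $n+1$ qubits (plus at most a constant number of ancilla qubits that start and end in $|0\rangle$) consisting of at most $c\,n^2$ elementary gates. In short, $C_N^{\mathrm{IV}}$ and $S_N^{\mathrm{IV}}$ can be realized with $O(\log^2 N)$ elementary quantum gates.
   Context: Qubit/basis conventions: the state space of $m$ qubits is $\mathbb{C}^{2^m}$ with computational basis $|x\rangle$, $x$ a bit string $b_m\dots b_1$ identified with the integer $\sum_k b_k2^{k-1}$; the most significant bit corresponds to the leftmost tensor factor. Elementary gates: (i) a CNOT between any two qubits, and (ii) any single-qubit gate $I_{2^{m-t}}\otimes U\otimes I_{2^{t-1}}$ with $U\in\mathcal U(2)$ arbitrary. A circuit realizes a unitary $W$ if the product of its gates equals $W$ (ancillas, if any, mapped $|0\rangle\mapsto|0\rangle$). $A\oplus B$ is the block-diagonal matrix with blocks $A,B$. Type IV transforms: $C_N^{\mathrm{IV}}=\sqrt{2/N}\,[\cos((j+\tfrac12)(k+\tfrac12)\pi/N)]_{j,k=0,\dots,N-1}$ and $S_N^{\mathrm{IV}}=\sqrt{2/N}\,[\sin((j+\tfrac12)(k+\tfrac12)\pi/N)]_{j,k=0,\dots,N-1}$; $i=\sqrt{-1}$. *)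

(* Defs.v *)
(* R : realType (MathComp-Analysis), complex numbers R[i]
   from mathcomp-real-closed (every realType is an rcfType). *)
From HB Require Import structures.
From mathcomp Require Import all_boot all_order all_algebra.
From mathcomp Require Import complex.
From mathcomp Require Import reals trigo.
Set Implicit Arguments. Unset Strict Implicit. Unset Printing Implicit Defensive.
Import Order.TTheory GRing.Theory Num.Theory.
Local Open Scope ring_scope.
Local Open Scope complex_scope.

Section QC.
Variable R : realType.
Local Notation C := R[i].

(* bit b_k of x (1-indexed): x = sum_k b_k 2^(k-1) *)
Definition bitq (k x : nat) : bool := odd (x %/ 2 ^ k.-1).

(* I_{2^(m-t)} (x) U (x) I_{2^(t-1)}, written out entrywise:
   entry (x,y) = U_{b_t(x), b_t(y)} if all other bits of x and y agree, else 0 *)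
Definition single_gate_mx (m t : nat) (U : 'M[C]_2) : 'M[C]_(2 ^ m) :=
  \matrix_(x, y)
    if (x %/ 2 ^ t == y %/ 2 ^ t)%N && (x %% 2 ^ t.-1 == y %% 2 ^ t.-1)%N
    then U (inord (bitq t x)) (inord (bitq t y)) else 0.

(* CNOT with control qubit c and target qubit t: |x> |-> |x xor b_c(x) 2^(t-1)> *)
Definition cnot_image (c t x : nat) : nat :=
  if bitq c x then (if bitq t x then x - 2 ^ t.-1 else x + 2 ^ t.-1)%N else x.

Definition cnot_mx (m c t : nat) : 'M[C]_(2 ^ m) :=
  \matrix_(x, y) if (x : nat) == cnot_image c t y then 1 else 0.

Definition conjT {p q : nat} (A : 'M[C]_(p, q)) : 'M[C]_(q, p) :=
  (map_mx (fun z : C => z^*) A)^T.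

Definition unitary {p : nat} (U : 'M[C]_p) : Prop := U *m conjT U = 1%:M.

Inductive gate : Type :=
  | GCNOT (c t : nat)
  | GSingle (t : nat) (U : 'M[C]_2).

(* elementary gates on m qubits (qubits numbered 1..m) *)
Definition gate_ok (m : nat) (g : gate) : Prop :=
  match g with
  | GCNOT c t => [/\ (1 <= c <= m)%N, (1 <= t <= m)%N & c != t]
  | GSingle t U => (1 <= t <= m)%N /\ unitary U
  end.

Fixpoint gates_ok (m : nat) (gs : seq gate) : Prop :=
  match gs with
  | [::] => True
  | g :: gs' => gate_ok m g /\ gates_ok m gs'
  end.

Definition gate_mx (m : nat) (g : gate) : 'M[C]_(2 ^ m) :=
  match g with
  | GCNOT c t => cnot_mx m c t
  | GSingle t U => single_gate_mx m t U
  end.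

(* product of the gates of a circuit (a list of gates) *)
Definition circuit_mx (m : nat) (gs : seq gate) : 'M[C]_(2 ^ m) :=
  foldr (fun g M => gate_mx m g *m M) 1%:M gs.

(* entries of a square matrix indexed by naturals, 0 outside the range *)
Definition natmx {p : nat} (A : 'M[C]_p) (i j : nat) : C :=
  match @insub _ (fun k => (k < p)%N) 'I_p i, @insub _ (fun k => (k < p)%N) 'I_p j with
  | Some i', Some j' => A i' j'
  | _, _ => 0
  end.

(* G (on m qubits, the extra qubits being the most significant ones = ancillas)
   realizes W (on the 2^k... i.e. p least significant basis states):
   G (|0..0> (x) |psi>) = |0..0> (x) W |psi> *)
Definition realizes {m p : nat} (G : 'M[C]_(2 ^ m)) (W : 'M[C]_p) : Prop :=
  forall i j : 'I_(2 ^ m), (j < p)%N -> G i j = natmx W i j.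

(* type IV DCT and DST *)
Definition DCT4 (N : nat) : 'M[C]_N :=
  \matrix_(j, k) (Num.sqrt (2 / N%:R) *
     cos ((j%:R + 2^-1) * (k%:R + 2^-1) * pi / N%:R))%:C.

Definition DST4 (N : nat) : 'M[C]_N :=
  \matrix_(j, k) (Num.sqrt (2 / N%:R) *
     sin ((j%:R + 2^-1) * (k%:R + 2^-1) * pi / N%:R))%:C.

(* C_N^IV (+) (-i) S_N^IV, a 2N x 2N matrix *)
Definition DCT4_DST4 (N : nat) : 'M[C]_(N + N) :=
  block_mx (DCT4 N) 0 0 ((- 'i) *: DST4 N).

End QC.

(* Main.v *)
Require Import Defs.
From HB Require Import structures.
From mathcomp Require Import all_boot all_order all_algebra.
From mathcomp Require Import complex.
From mathcomp Require Import boolp reals trigo.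
From mathcomp Require Import zify ring.
Import Order.TTheory GRing.Theory Num.Theory.
Local Open Scope ring_scope.

(* Let [L = 2^(n+1) = 2N], [E(x, y) = L^(-1/2) exp(-2 i pi (x + 1/2) (y + 1/2) / L)].
   Replacing [x] by its bitwise complement [L - 1 - x] turns [E(x, y)] into minus its
   conjugate, so passing to the symmetric and antisymmetric combinations of [|k>] and
   [|L-1-k>] on both sides splits [E] into a cosine block and a sine block:
   [P E P^T = C_N^IV (+) (-i) S_N^IV], where [P] costs [n] CNOTs controlled by the top
   qubit and two single-qubit gates.  The matrix [E] is the Fourier transform up to
   single-qubit phases: Hadamards interleaved with controlled phases (each made of two
   CNOTs and three single-qubit gates), followed by the bit reversal.  No ancilla is
   needed. *)

(** * Binary digits *)

(* 0-indexed: [bits x k = bitq k.+1 x]. *)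
Definition bits (x k : nat) : bool := odd (x %/ 2 ^ k).

Definition upd (x : nat -> bool) (t : nat) (c : bool) : nat -> bool :=
  fun k => if k == t then c else x k.

Definition bitval (m : nat) (x : nat -> bool) : nat :=
  (\sum_(k < m) x k * 2 ^ k)%N.

(** Counterpart of [upd] on numbers: [./2.*2] clears digit [t], and [c] refills it. *)
Definition setbit (x t : nat) (c : bool) : nat :=
  (((x %/ 2 ^ t)./2.*2 + c) * 2 ^ t + x %% 2 ^ t)%N.

Lemma bitsS x k : bits x k.+1 = bits x./2 k.
Proof. by rewrite /bits expnS divnMA divn2. Qed.

Lemma bits0 x : bits x 0 = odd x.
Proof. by rewrite /bits divn1. Qed.

Lemma bitval_bits m x : (x < 2 ^ m)%N -> bitval m (bits x) = x.
Proof.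
elim: m x => [|m IH] x; first by rewrite /bitval big_ord0; case: x.
rewrite expnS => lt_x; rewrite /bitval big_ord_recl /= bits0 muln1.
under eq_bigr => i _ do rewrite /bump /= add1n bitsS expnS mulnCA.
rewrite -big_distrr /= -/(bitval m (bits x./2)) IH; last by lia.
by rewrite mul2n odd_double_half.
Qed.

(** Both numbers are below 2^(x + y), so [bitval] with x + y digits recovers each of them. *)
Lemma bits_inj : injective bits.
Proof.
move=> x y eq_xy; pose m := (x + y)%N.
have lt_m z : (z <= m -> z < 2 ^ m)%N by move=> le_zm; apply: leq_ltn_trans le_zm (ltn_expl _ _).
by rewrite -(bitval_bits m x) ?eq_xy ?bitval_bits ?lt_m ?leq_addr ?leq_addl.
Qed.

Lemma bits_cat q s r k : (r < 2 ^ s)%N ->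
  bits (q * 2 ^ s + r) k = if (k < s)%N then bits r k else bits q (k - s).
Proof.
move=> lt_r; case: ltnP => [lt_ks|le_sk].
  rewrite /bits -(subnK (ltnW lt_ks)) expnD mulnA divnMDl ?expn_gt0 //.
  by rewrite oddD oddM oddX subn_eq0 leqNgt lt_ks andbF.
by rewrite /bits -{1}(subnKC le_sk) expnD divnMA divnMDl ?expn_gt0 // (divn_small lt_r) addn0.
Qed.

Lemma bits_setbit x t c : bits (setbit x t c) = upd (bits x) t c.
Proof.
have lt_r : (x %% 2 ^ t < 2 ^ t)%N by rewrite ltn_mod expn_gt0.
apply/funext => k; rewrite /upd bits_cat //.
have -> : bits x k = if (k < t)%N then bits (x %% 2 ^ t) k
    else bits (x %/ 2 ^ t) (k - t).
  by rewrite {1}(divn_eq x (2 ^ t)) bits_cat.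
case: ltngtP => // [lt_tk|->]; last by rewrite subnn bits0 oddD odd_double oddb.
case: (k - t)%N (subn_gt0 t k) => [|d _]; first by rewrite lt_tk.
by rewrite !bitsS halfD odd_double /= doubleK; case: c => /=; rewrite addn0.
Qed.

Lemma setbit_lt m x t c : (x < 2 ^ m)%N -> (t < m)%N -> (setbit x t c < 2 ^ m)%N.
Proof.
move=> lt_x lt_t; rewrite /setbit -(subnK (ltnW lt_t)) expnD.
have : (x %/ 2 ^ t < 2 ^ (m - t))%N by rewrite ltn_divLR ?expn_gt0 // -expnD subnK // ltnW.
have lt_r : (x %% 2 ^ t < 2 ^ t)%N by rewrite ltn_mod expn_gt0.
have -> : (m - t = (m - t.+1).+1)%N by lia.
rewrite expnS; set q := (x %/ _)%N; set K := (2 ^ (_ - _))%N => lt_q.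
have lt_q' : (q./2.*2 + c < 2 * K)%N by lia.
apply: (@leq_trans ((q./2.*2 + c).+1 * 2 ^ t)); last by rewrite leq_mul2r lt_q' orbT.
by rewrite mulSnr ltn_add2l.
Qed.

Lemma upd_id x t : upd x t (x t) = x.
Proof. by apply/funext => k; rewrite /upd; case: eqP => // ->. Qed.

Lemma updd x t c : upd x t c t = c.
Proof. by rewrite /upd eqxx. Qed.

Lemma upd_upd x t c d : upd (upd x t c) t d = upd x t d.
Proof. by apply/funext => k; rewrite /upd; case: eqP. Qed.

Lemma upd_neq x t c k : k != t -> upd x t c k = x k.
Proof. by rewrite /upd => /negbTE ->. Qed.

(** The boolean condition is the support of [single_gate_mx]: row [x] meets only the columns that
    differ from [x] at most in digit [t]. *)
Lemma setbit_bitsP x z t :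
  reflect (z = setbit x t (bits z t))
    ((x %/ 2 ^ t.+1 == z %/ 2 ^ t.+1)%N && (x %% 2 ^ t == z %% 2 ^ t)%N).
Proof.
have divS w : (w %/ 2 ^ t.+1 = (w %/ 2 ^ t)./2)%N by rewrite expnSr divnMA divn2.
have defz : z = setbit z t (bits z t) by apply: bits_inj; rewrite bits_setbit upd_id.
apply: (iffP andP) => [[/eqP eq_h /eqP eq_l]|->].
  by rewrite {1}defz /setbit -!divS eq_h eq_l.
rewrite /setbit !divS divnMDl ?expn_gt0 // modnMDl modn_mod.
rewrite (divn_small (ltn_pmod _ _)) ?expn_gt0 // addn0 halfD odd_double /= doubleK.
by case: (bits z t); rewrite /= ?addn0.
Qed.

(** No carry or borrow occurs: 2^t is added when digit [t] is 0 and subtracted when it is 1. *)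
Lemma bits_cnot_image c t x : c != t ->
  bits (cnot_image c.+1 t.+1 x) = upd (bits x) t (bits x t (+) bits x c).
Proof.
move=> ct; rewrite -bits_setbit; congr bits; rewrite /cnot_image /bitq /= -!/(bits _ _).
have defx : x = setbit x t (bits x t) by apply: bits_inj; rewrite bits_setbit upd_id.
case: (bits x c); last by rewrite addbF.
move: defx; rewrite /setbit; set q := _./2.*2; set r := (x %% _)%N.
by case: (bits x t) => /= defx; rewrite ?mulnDl ?mul1n ?mul0n in defx *; lia.
Qed.

(** * Circuits acting on functions of bit strings *)

Section Circuits.
Variable R : realType.
Local Notation C := R[i].

(* The action of a gate on the column vector whose entry at index [i] is [F (bits i)]. *)
Definition act (g : gate R) (F : (nat -> bool) -> C) : (nat -> bool) -> C :=
  match g with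
  | GCNOT c t => fun x => F (upd x t.-1 (x t.-1 (+) x c.-1))
  | GSingle t U => fun x =>
      \sum_(b : bool) U (inord (x t.-1)) (inord b) * F (upd x t.-1 b)
  end.

(** The list is read as a matrix product, as in [circuit_mx], so its last gate acts first. *)
Definition run (gs : seq (gate R)) (F : (nat -> bool) -> C) := foldr act F gs.

Lemma run_nil F : run [::] F = F.
Proof. by []. Qed.

Lemma run_cons g gs F : run (g :: gs) F = act g (run gs F).
Proof. by []. Qed.

Lemma run_cat gs hs F : run (gs ++ hs) F = run gs (run hs F).
Proof. exact: foldr_cat. Qed.

Lemma run_flatten_cons (f : nat -> seq (gate R)) j r F :
  run (flatten [seq f k | k <- j :: r]) F =
  run (f j) (run (flatten [seq f k | k <- r]) F).
Proof. exact: run_cat. Qed.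

(** Row [i] of a CNOT has its only nonzero entry at the flipped index, since the flip is an
    involution; row [i] of a single-qubit gate is supported on the two indices obtained by setting
    digit [t] of [i]. *)
Lemma gate_mx_act m g p (A : 'M[C]_(2 ^ m, p)) (j : 'I_p) F : gate_ok m g ->
  (forall i, A i j = F (bits i)) ->
  forall i, (gate_mx m g *m A) i j = act g F (bits i).
Proof.
move=> ok_g AF i; rewrite mxE; case: g ok_g => [c t [c_ok t_ok ct]|t U [t_ok _]] /=.
  case: c t c_ok t_ok ct => [|c] [|t] //= lt_c lt_t; rewrite eqSS => ct.
  set z := setbit i t (bits i t (+) bits i c).
  have lt_z : (z < 2 ^ m)%N by apply: setbit_lt.
  have bits_z : bits z = upd (bits i) t (bits i t (+) bits i c) by rewrite bits_setbit.
  rewrite (bigD1 (Ordinal lt_z)) //= big1 ?addr0 => [|k ne_k].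
    rewrite mxE AF /= bits_z ifT ?mul1r //; apply/eqP/bits_inj.
    rewrite bits_cnot_image //= bits_z updd (upd_neq _ _ _ _ ct) upd_upd.
    by rewrite -addbA addbb addbF upd_id.
  rewrite mxE ifF ?mul0r //; apply: contraNF ne_k => /eqP def_i.
  apply/eqP/val_inj/bits_inj; rewrite /= bits_z def_i bits_cnot_image // updd.
  by rewrite (upd_neq _ _ _ _ ct) upd_upd -addbA addbb addbF upd_id.
case: t t_ok => [|t] //= lt_t.
have lt_z b : (setbit i t b < 2 ^ m)%N by apply: setbit_lt.
have eq_z b : F (upd (bits i) t b) = A (Ordinal (lt_z b)) j by rewrite AF bits_setbit.
under [RHS]eq_bigr => b _ do rewrite eq_z.
(* Columns are grouped by digit [t]; each group contains a single index that agrees with [i] in all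
   other digits. *)
rewrite (partition_big (fun k : 'I_(2 ^ m) => bits k t) xpredT) //=.
apply: eq_bigr => b _; rewrite (bigD1 (Ordinal (lt_z b))) /=; last by rewrite bits_setbit updd.
rewrite big1 ?addr0 => [|k /andP[/eqP kb ne_k]].
  rewrite mxE ifT; first by rewrite /bitq /= -!/(bits _ _) bits_setbit updd.
  by apply/setbit_bitsP; rewrite bits_setbit updd.
rewrite mxE ifF ?mul0r //; apply: contraNF ne_k => /setbit_bitsP def_k.
by apply/eqP/val_inj; rewrite /= def_k kb.
Qed.

Lemma circuit_mx_run m gs p (A : 'M[C]_(2 ^ m, p)) (j : 'I_p) F : gates_ok m gs ->
  (forall i, A i j = F (bits i)) ->
  forall i, (circuit_mx m gs *m A) i j = run gs F (bits i).
Proof.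
elim: gs => [|g gs IH] /=; first by move=> _ AF i; rewrite mul1mx.
by move=> [ok_g ok_gs] AF i; rewrite -mulmxA; apply: gate_mx_act => // k; apply: IH.
Qed.

Lemma gates_ok_cat m (gs hs : seq (gate R)) :
  gates_ok m (gs ++ hs) <-> gates_ok m gs /\ gates_ok m hs.
Proof. by elim: gs => [|g gs IH] /=; [split=> // -[] | rewrite IH; tauto]. Qed.

Lemma circuit_mx_cat m (gs hs : seq (gate R)) :
  circuit_mx m (gs ++ hs) = circuit_mx m gs *m circuit_mx m hs.
Proof. by elim: gs => [|g gs IH] /=; rewrite ?mul1mx // IH mulmxA. Qed.
(** * Gates *)

Local Open Scope complex_scope.

Lemma exp2_neq0 m : (2 ^+ m : R) != 0.
Proof. by rewrite expf_neq0 // pnatr_eq0. Qed.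

#[local] Arguments conjc : simpl never.

(** This is exp(i pi t). With pi kept outside, all angles are rational expressions in powers of 2,
    which [field] can compare. *)
Definition expipi (t : R) : C := cos (pi * t) +i* sin (pi * t).

Lemma expipiD s t : expipi (s + t) = expipi s * expipi t.
Proof.
by rewrite /expipi mulrDr cosD sinD; apply/eqP; rewrite eq_complex /= eqxx /= addrC.
Qed.

Lemma expipi0 : expipi 0 = 1.
Proof. by rewrite /expipi mulr0 cos0 sin0. Qed.

Lemma expipi1 : expipi 1 = - 1.
Proof. by rewrite /expipi mulr1 cospi sinpi; apply/eqP; rewrite eq_complex /= oppr0 !eqxx. Qed.

Lemma expipiN1 : expipi (- 1) = - 1.
Proof. by rewrite /expipi mulrN1 cosN sinN cospi sinpi; apply/eqP; rewrite eq_complex /= !eqxx. Qed.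

Lemma conj_expipi t : conjc (expipi t) = expipi (- t).
Proof. by rewrite /expipi mulrN cosN sinN. Qed.

Lemma expipi_mulN t : expipi t * expipi (- t) = 1.
Proof. by rewrite -expipiD subrr expipi0. Qed.

Lemma expipi_sum I (r : seq I) (P : pred I) (f : I -> R) :
  \prod_(i <- r | P i) expipi (f i) = expipi (\sum_(i <- r | P i) f i).
Proof. by rewrite (big_morph _ expipiD expipi0). Qed.

Lemma expipi_even (n : nat) : expipi (- n.*2%:R) = 1.
Proof.
elim: n => [|n IH]; first by rewrite oppr0 expipi0.
have -> : - (n.+1).*2%:R = - n.*2%:R + (- 1 + - 1) :> R by rewrite doubleS -addn2 natrD; ring.
by rewrite !expipiD IH expipiN1; ring.
Qed.

Definition mx2 (u : bool -> bool -> C) : 'M[C]_2 := \matrix_(i, j) u (odd i) (odd j).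

Lemma mx2E u (b c : bool) : mx2 u (inord b) (inord c) = u b c.
Proof. by rewrite mxE !inordK ?oddb //; case: (b) (c) => -[]. Qed.

Lemma unitary_mx2 u :
  (forall b c, u b false * conjc (u c false) + u b true * conjc (u c true) = (b == c)%:R) ->
  unitary (mx2 u).
Proof.
move=> uP; apply/matrixP => i j; rewrite mxE !big_ord_recl big_ord0 !mxE /= addr0 uP.
by case: i j => -[|[|//]] ? [[|[|//]] ?].
Qed.

Definition rsqrt2 : C := (Num.sqrt 2^-1)%:C.

Lemma rsqrt2_sqr : rsqrt2 * rsqrt2 = 2^-1.
Proof.
rewrite /rsqrt2 -rmorphM /= -expr2 sqr_sqrtr ?invr_ge0 //.
by rewrite fmorphV rmorph_nat.
Qed.

Definition phase_gate (t : nat) (a b : R) : gate R :=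
  GSingle t.+1 (mx2 (fun i j => if i == j then expipi (if i then b else a) else 0)).

Definition had_gate (t : nat) : gate R :=
  GSingle t.+1 (mx2 (fun i j => rsqrt2 * expipi (- (i && j)%:R))).

Lemma phase_gate_ok m t a b : (t < m)%N -> gate_ok m (phase_gate t a b).
Proof.
move=> lt_tm; split=> //; apply: unitary_mx2.
have conj0 : conjc (0 : C) = 0 by rewrite conjc0.
by case=> -[] /=; rewrite ?conj0 ?conj_expipi ?expipi_mulN ?mulr0 ?mul0r ?addr0 ?add0r.
Qed.

Lemma had_gate_ok m t : (t < m)%N -> gate_ok m (had_gate t).
Proof.
move=> lt_tm; split=> //; apply: unitary_mx2.
have conjs : conjc rsqrt2 = rsqrt2 by rewrite /rsqrt2 conjc_real.
have h : (2 : C) != 0 by rewrite pnatr_eq0.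
have s2 (a b : C) : rsqrt2 * a * (rsqrt2 * b) = 2^-1 * (a * b).
  by rewrite mulrACA rsqrt2_sqr.
case=> -[] /=; rewrite ?oppr0 ?rmorphM /= ?conjs !conj_expipi !s2 ?opprK ?oppr0;
  rewrite ?expipi0 ?expipiN1 ?expipi1; by field.
Qed.

Lemma act_phase t a b F :
  act (phase_gate t a b) F = fun x => expipi (if x t then b else a) * F x.
Proof.
apply/funext => x /=; under eq_bigr => c _ do rewrite mx2E.
rewrite big_bool.
by case xt: (x t) => /=; rewrite mul0r ?addr0 ?add0r -xt upd_id.
Qed.

Lemma act_had t F :
  act (had_gate t) F = fun x => \sum_(b : bool)
    rsqrt2 * expipi (- (x t && b)%:R) * F (upd x t b).
Proof. by apply/funext => x /=; apply: eq_bigr => b _; rewrite mx2E. Qed.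

Lemma act_cnot c t F :
  act (GCNOT R c.+1 t.+1) F = fun x => F (upd x t (x t (+) x c)).
Proof. by []. Qed.

(* [2 b c = b + c - (b (+) c)] splits a controlled phase into local phases. *)
Definition cphase (j k : nat) (a : R) : seq (gate R) :=
  [:: phase_gate j 0 (a / 2); phase_gate k 0 (a / 2); GCNOT R j.+1 k.+1;
      phase_gate k 0 (- (a / 2)); GCNOT R j.+1 k.+1].

Lemma run_cphase j k a F : j != k ->
  run (cphase j k a) F = fun x => expipi (a * (x j && x k)%:R) * F x.
Proof.
move=> jk; rewrite /cphase !run_cons run_nil !act_phase !act_cnot; apply/funext => x /=.
rewrite !updd !(upd_neq _ _ _ _ jk) upd_upd -addbA addbb addbF upd_id !mulrA.
rewrite -!expipiD; congr (expipi _ * _).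
by case: (x j); case: (x k) => /=; field.
Qed.

Lemma run_cphases j (r : seq nat) (a : nat -> R) F : j \notin r ->
  run (flatten [seq cphase j k (a k) | k <- r]) F =
  fun x => (\prod_(k <- r) expipi (a k * (x j && x k)%:R)) * F x.
Proof.
elim: r => [|k r IH]; first by move=> _; apply/funext => x; rewrite big_nil mul1r.
rewrite inE negb_or => /andP[jk jr]; rewrite run_flatten_cons IH // run_cphase //.
by apply/funext => x; rewrite big_cons mulrA.
Qed.

(** * The shifted Fourier transform *)

(** Read from right to left: the last phase sees the input bit [j], the Hadamard gate replaces it by
    the output bit, and the remaining phases see the output bit [j] and the input bits below it. *)
Definition qft_stage (m j : nat) : seq (gate R) :=
  flatten [seq cphase j k (- (2 ^+ k / 2 ^+ j)) | k <- iota 0 j] ++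
  [:: phase_gate j 0 (- (2 ^+ j.+1)^-1); had_gate j; phase_gate j 0 (- (2 ^+ j / 2 ^+ m))].

(* Qubit [j] is transformed while all qubits [k < j] still carry their input bits [y k],
   so the entries stay products of one factor per qubit; the single-qubit phases
   account for the shifts by 1/2. *)
Definition qft_factor (m j : nat) (b : bool) (y : nat -> bool) : C :=
  rsqrt2 * expipi (- (b%:R / 2 ^+ j.+1)) * expipi (- ((y j)%:R * 2 ^+ j / 2 ^+ m)) *
  \prod_(0 <= k < j.+1) expipi (- ((b && y k)%:R * 2 ^+ k / 2 ^+ j)).

(** The hypothesis says that qubits 0 to [j] still hold the bits of [y], while [G x], the
    contribution of the other qubits, does not change with bit [j]. *)
Lemma run_qft_stage m j y F G :
  (forall x b, F (upd x j b) =
     (\prod_(0 <= k < j) (x k == y k)%:R) * (b == y j)%:R * G x) ->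
  run (qft_stage m j) F =
  fun x => (\prod_(0 <= k < j) (x k == y k)%:R) * (qft_factor m j (x j) y * G x).
Proof.
move=> FG; rewrite /qft_stage run_cat run_cphases ?mem_iota ?ltnn ?andbF //.
apply/funext => x; rewrite !run_cons run_nil !act_phase act_had.
have -> : iota 0 j = index_iota 0 j by rewrite /index_iota subn0.
rewrite big_bool /= !updd !FG.
set D := \prod_(0 <= k < j) (x k == y k)%:R.
(* [D] vanishes unless [x] and [y] agree below [j], so [x k] may be replaced by [y k] in front of
   it. *)
have DE : \prod_(k <- index_iota 0 j) expipi (- (2 ^+ k / 2 ^+ j) * (x j && x k)%:R) * D =
    \prod_(0 <= k < j) expipi (- ((x j && y k)%:R * 2 ^+ k / 2 ^+ j)) * D.
  rewrite -!big_split; apply: eq_bigr => k _ /=.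
  case: eqP => [->|_]; last by rewrite !mulr0.
  by congr (expipi _ * _); ring.
rewrite /qft_factor big_nat_recr //=.
(* The term k = j of the product is the sign produced by the Hadamard gate. *)
have e2 : expipi (- ((x j && y j)%:R * 2 ^+ j / 2 ^+ j)) = expipi (- (x j && y j)%:R).
  by rewrite mulfK // exp2_neq0.
rewrite e2; transitivity (\prod_(0 <= k < j) expipi (- ((x j && y k)%:R * 2 ^+ k / 2 ^+ j)) * D *
  (rsqrt2 * expipi (- ((x j)%:R / 2 ^+ j.+1)) *
   expipi (- ((y j)%:R * 2 ^+ j / 2 ^+ m)) * expipi (- (x j && y j)%:R) * G x)); last by ring.
rewrite -DE.
have -> : expipi (if x j then - (2 ^+ j.+1)^-1 else 0) = expipi (- ((x j)%:R / 2 ^+ j.+1)).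
  by case: (x j); rewrite /= ?mul1r ?mul0r ?oppr0.
case: (y j) => /=; rewrite ?mul1r ?mul0r ?oppr0; ring.
Qed.

(** Induction on the number [d] of completed stages, from the top qubit downwards: the lower m - d
    qubits still carry [y], and the upper [d] have turned into factors. *)
Lemma run_qft_stages m d y : (d <= m)%N ->
  run (flatten [seq qft_stage m j | j <- iota (m - d) d])
      (fun x => \prod_(0 <= k < m) (x k == y k)%:R) =
  fun x => (\prod_(0 <= k < m - d) (x k == y k)%:R) *
           \prod_(m - d <= j < m) qft_factor m j (x j) y.
Proof.
elim: d => [|d IH] le_dm.
  by apply/funext => x; rewrite subn0 [X in _ * X]big_geq ?mulr1.
have defj : (m - d)%N = (m - d.+1).+1 by lia.
rewrite [iota _ d.+1]/= run_flatten_cons -defj IH ?(ltnW le_dm) // defj; set j := (m - d.+1)%N.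
have lt_j : (j < m)%N by rewrite /j; lia.
rewrite (run_qft_stage _ _ y _ (fun x => \prod_(j.+1 <= i < m) qft_factor m i (x i) y)).
  by apply/funext => x; rewrite [in RHS](big_ltn lt_j).
move=> x b; rewrite big_nat_recr //= updd; congr (_ * _ * _).
  by apply: eq_big_nat => k /andP[_ lt_k]; rewrite upd_neq // neq_ltn lt_k.
by apply: eq_big_nat => k /andP[lt_k _]; rewrite upd_neq // neq_ltn lt_k orbT.
Qed.

(** * Bit reversal *)

Definition swap (j k : nat) : seq (gate R) :=
  [:: GCNOT R j.+1 k.+1; GCNOT R k.+1 j.+1; GCNOT R j.+1 k.+1].

Lemma run_swap j k F : j != k ->
  run (swap j k) F = fun x => F (upd (upd x j (x k)) k (x j)).
Proof.
move=> jk; apply/funext => x; rewrite /swap !run_cons run_nil !act_cnot /upd /=; congr F; apply/funext => l.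
have kj : (k == j) = false by rewrite eq_sym (negbTE jk).
rewrite !eqxx !(negbTE jk) !kj.
case: (eqVneq l k) => _; first by case: (x j); case: (x k).
by case: (eqVneq l j) => // _; case: (x j); case: (x k).
Qed.

Definition bitrev (m : nat) (x : nat -> bool) : nat -> bool :=
  fun k => if (k < m)%N then x (m.-1 - k)%N else x k.

Definition reversal (m : nat) : seq (gate R) :=
  flatten [seq swap j (m.-1 - j) | j <- iota 0 m./2].

Lemma run_reversal m F : run (reversal m) F = fun x => F (bitrev m x).
Proof.
rewrite /reversal.
(* The swaps act from the innermost pair outwards: after [h] of them a central window is
   reversed. *)
have gen h : (h <= m./2)%N -> run (flatten [seq swap j (m.-1 - j) | j <- iota (m./2 - h) h]) F =
    fun x => F (fun k => if (m./2 - h <= k < m - (m./2 - h))%N then x (m.-1 - k)%N else x k).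
  elim: h => [|h IH] le_h.
    (* The initial window is empty for even [m], and for odd [m] it is the middle index, which
       reversal fixes. *)
    apply/funext => x; congr F; apply/funext => k; case: ifP => // k_mid.
    by congr x; lia.
  have defj : (m./2 - h)%N = (m./2 - h.+1).+1 by lia.
  rewrite [iota _ h.+1]/= run_flatten_cons -defj IH ?(ltnW le_h) // defj; set j := (m./2 - h.+1)%N.
  have lt_j : (j < m./2)%N by rewrite /j; lia.
  have ne_j : j != (m.-1 - j)%N by lia.
  rewrite run_swap //; apply/funext => x; congr F; apply/funext => k; rewrite /upd.
  case: ifP => k_mid.
    have -> : ((m.-1 - k)%N == (m.-1 - j)%N) = false by lia.
    have -> : ((m.-1 - k)%N == j) = false by lia.
    by rewrite ifT //; lia.
  case: eqP => [->|ne_k1]; first by rewrite ifT; [congr x; lia | lia].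
  case: eqP => [->|ne_k2]; first by rewrite ifT; [congr x; lia | lia].
  by rewrite ifF //; lia.
have := gen _ (leqnn _); rewrite subnn => ->; apply/funext => x; congr F.
by apply/funext => k; rewrite /bitrev subn0.
Qed.

(** For k > j the angle of bit [k] is an even multiple of pi, so the product over the bits up to [j]
    extends to all of [y] at no cost. *)
Lemma qft_factorE m j b y : (j < m)%N -> qft_factor m j b y =
  rsqrt2 * expipi (- (b%:R / 2 ^+ j.+1)) * expipi (- ((y j)%:R * 2 ^+ j / 2 ^+ m)) *
  expipi (- (b%:R * (bitval m y)%:R / 2 ^+ j)).
Proof.
move=> lt_jm; rewrite /qft_factor; congr (_ * _).
transitivity (\prod_(0 <= k < m) expipi (- ((b && y k)%:R * 2 ^+ k / 2 ^+ j))).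
  rewrite [RHS](@big_cat_nat _ _ _ j.+1) //= [X in _ * X]big1_seq ?mulr1 // => k.
  rewrite mem_index_iota => /andP[_ /andP[lt_jk _]].
  have -> : (b && y k)%:R * 2 ^+ k / 2 ^+ j = ((b && y k) * 2 ^ (k - j.+1)).*2%:R :> R.
    have -> : 2 ^+ k = 2 ^+ (k - j.+1) * 2 * 2 ^+ j :> R.
      by rewrite -exprSr -exprD; congr (_ ^+ _); lia.
    by rewrite !mulrA mulfK ?exp2_neq0 // -muln2 !natrM natrX.
  exact: expipi_even.
rewrite expipi_sum sumrN /bitval natr_sum mulr_sumr mulr_suml big_mkord.
congr (expipi (- _)); apply: eq_bigr => k _.
by rewrite natrM natrX mulrA -natrM mulnb.
Qed.

(** The phase gate with two equal angles is the scalar exp(-i pi / (2 L)), L = 2^m, which comes from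
    the product of the two shifts by 1/2. *)
Definition dft_circuit (m : nat) : seq (gate R) :=
  reversal m ++ phase_gate 0 (- (2 * 2 ^+ m)^-1) (- (2 * 2 ^+ m)^-1) ::
  flatten [seq qft_stage m j | j <- iota 0 m].

(** The angle theta(x, y) of the matrix E with L = 2^m, in units of pi and without its sign. *)
Definition dft_phase (m x y : nat) : R := 2 * (x%:R + 2^-1) * (y%:R + 2^-1) / 2 ^+ m.

Definition dft_entry (m x y : nat) : C :=
  rsqrt2 ^+ m * expipi (- dft_phase m x y).

Lemma run_dft m (y : nat -> bool) : run (dft_circuit m) (fun x => \prod_(0 <= k < m) (x k == y k)%:R) =
  fun x => dft_entry m (bitval m x) (bitval m y).
Proof.
rewrite /dft_circuit run_cat run_reversal.
have := run_qft_stages m m y (leqnn m); rewrite subnn => stagesE.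
rewrite run_cons act_phase stagesE; apply/funext => x; rewrite [X in _ * (X * _)]big_geq // mul1r if_same.
(* Qubit m - 1 - i carries bit [i] of the reversed index, so this reindexing puts the output bits in
   natural order. *)
rewrite big_mkord (reindex_inj rev_ord_inj) /=.
pose X i : R := (x i)%:R * 2 ^+ i.
pose Y i : R := (y i)%:R * 2 ^+ i.
transitivity (expipi (- (2 * 2 ^+ m)^-1) * \prod_(i < m) (rsqrt2 *
   expipi (- (X i / 2 ^+ m)) * expipi (- (Y (m - i.+1)%N / 2 ^+ m)) *
   expipi (- (X i * (2 * (bitval m y)%:R / 2 ^+ m))))).
  congr (_ * _); apply: eq_bigr => i _; rewrite qft_factorE ?rev_ord_proof //.
  have lt_i := ltn_ord i.
  have -> : bitrev m x (m - i.+1)%N = x i.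
    by rewrite /bitrev ifT; [congr x; lia | lia].
  (* Turns the denominator of stage m - 1 - i into the binary weight 2^i over 2^m. *)
  have e1 : (2 ^+ m : R) = 2 ^+ (m - i.+1).+1 * 2 ^+ i by rewrite -exprD; congr (_ ^+ _); lia.
  rewrite /X /Y; congr (_ * expipi _ * expipi _ * expipi _); rewrite e1.
  - by field; rewrite ?exp2_neq0.
  - by rewrite exprS; field; rewrite ?exp2_neq0.
rewrite !big_split /= !expipi_sum prodr_const card_ord !sumrN -!mulr_suml.
have -> : \sum_(i < m) Y (m - i.+1)%N = \sum_(i < m) Y i.
  by rewrite [RHS](reindex_inj rev_ord_inj).
have valE (z : nat -> bool) : \sum_(i < m) (z i)%:R * 2 ^+ i = (bitval m z)%:R :> R.
  by rewrite /bitval natr_sum; apply: eq_bigr => i _; rewrite natrM natrX.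
rewrite /X /Y !valE /dft_entry /dft_phase.
rewrite mulrC -!(mulrA (rsqrt2 ^+ m)) -!expipiD; congr (_ * expipi _).
by field; rewrite ?exp2_neq0.
Qed.

(** Writes a basis vector as one delta per qubit, the input format of [run_dft]. *)
Lemma bits_eq_prod m (i j : 'I_(2 ^ m)) :
  (i == j)%:R = \prod_(0 <= k < m) (bits i k == bits j k)%:R :> C.
Proof.
rewrite big_mkord; case: eqP => [->|ne_ij].
  by rewrite big1 // => k _; rewrite eqxx.
symmetry; apply/eqP; apply: contra_notT ne_ij => /prodf_neq0 bits_ij.
apply: val_inj; rewrite /= -(bitval_bits m i) // -(bitval_bits m j) //.
apply: eq_bigr => k _; move: (bits_ij k isT).
by rewrite pnatr_eq0 eqb0 negbK => /eqP ->.
Qed.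

(** * Validity and size of the Fourier circuit *)

Lemma gates_ok_flatten m (f : nat -> seq (gate R)) (r : seq nat) :
  (forall k, k \in r -> gates_ok m (f k)) -> gates_ok m (flatten [seq f k | k <- r]).
Proof.
elim: r => [|k r IH] //= fr; apply/gates_ok_cat; split; first by apply: fr; rewrite mem_head.
by apply: IH => l lr; apply: fr; rewrite inE lr orbT.
Qed.

Lemma size_flatten_le (f : nat -> seq (gate R)) (r : seq nat) (c : nat) :
  (forall k, k \in r -> (size (f k) <= c)%N) ->
  (size (flatten [seq f k | k <- r]) <= size r * c)%N.
Proof.
elim: r => [|k r IH] //= fr; rewrite size_cat mulSn leq_add ?fr ?mem_head //.
by apply: IH => l lr; apply: fr; rewrite inE lr orbT.
Qed.

Lemma qft_stage_ok m j : (j < m)%N -> gates_ok m (qft_stage m j).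
Proof.
move=> lt_jm; apply/gates_ok_cat; split.
  apply: gates_ok_flatten => k; rewrite mem_iota add0n => /= lt_kj.
  have lt_km : (k < m)%N by apply: leq_trans lt_jm; apply: ltnW.
  have ne_jk : j.+1 != k.+1 by rewrite eqSS neq_ltn lt_kj orbT.
  have cnot_ok : gate_ok m (GCNOT R j.+1 k.+1) by [].
  exact: (conj (phase_gate_ok m _ _ _ lt_jm) (conj (phase_gate_ok m _ _ _ lt_km)
    (conj cnot_ok (conj (phase_gate_ok m _ _ _ lt_km) (conj cnot_ok I))))).
exact: (conj (phase_gate_ok m _ _ _ lt_jm) (conj (had_gate_ok m _ lt_jm)
  (conj (phase_gate_ok m _ _ _ lt_jm) I))).
Qed.

Lemma reversal_ok m : gates_ok m (reversal m).
Proof.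
apply: gates_ok_flatten => j; rewrite mem_iota add0n => /= lt_jm.
by do !split; lia.
Qed.

Lemma dft_circuit_ok m : (0 < m)%N -> gates_ok m (dft_circuit m).
Proof.
move=> m_gt0; apply/gates_ok_cat; split; first exact: reversal_ok.
split; first exact: phase_gate_ok.
by apply: gates_ok_flatten => j; rewrite mem_iota => /= lt_j; apply: qft_stage_ok.
Qed.

(** Three CNOTs per swap, one scalar phase, and in each of the [m] stages at most [m] controlled
    phases of five gates plus three single-qubit gates. *)
Lemma size_dft_circuit m : (size (dft_circuit m) <= m./2 * 3 + 1 + m * (5 * m + 3))%N.
Proof.
have rev_size : (size (reversal m) <= m./2 * 3)%N.
  by apply: leq_trans (size_flatten_le _ _ 3 _) _; rewrite ?size_iota.
rewrite size_cat /= -addSnnS -addn1; apply: leq_add; first exact: leq_add.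
apply: leq_trans (size_flatten_le _ _ (5 * m + 3) _) _; last by rewrite size_iota.
move=> j; rewrite mem_iota => /= lt_jm.
rewrite size_cat leq_add2r; apply: (@leq_trans (j * 5)); last by lia.
by apply: leq_trans (size_flatten_le _ _ 5 _) _; rewrite ?size_iota.
Qed.

Lemma dft_circuit_mxE m (i j : 'I_(2 ^ m)) : (0 < m)%N ->
  circuit_mx m (dft_circuit m) i j = dft_entry m i j.
Proof.
move=> m_gt0; rewrite -[circuit_mx _ _]mulmx1.
rewrite (@circuit_mx_run _ _ _ _ _ (fun x => \prod_(0 <= k < m) (x k == bits j k)%:R)).
- by rewrite run_dft !bitval_bits.
- exact: dft_circuit_ok.
- by move=> k; rewrite mxE -bits_eq_prod.
Qed.

(** * Splitting into cosine and sine blocks *)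

(** The permutation matrix of an involution is symmetric. *)
Lemma trmx_cnot m c t : gate_ok m (GCNOT R c t) -> (cnot_mx R m c t)^T = cnot_mx R m c t.
Proof.
case=> c_ok t_ok; case: c t c_ok t_ok => [|c] [|t] // _ _; rewrite eqSS => ct.
have inv x : cnot_image c.+1 t.+1 (cnot_image c.+1 t.+1 x) = x.
  apply: bits_inj; rewrite !bits_cnot_image // updd (upd_neq _ _ _ _ ct) upd_upd.
  by rewrite -addbA addbb addbF upd_id.
apply/matrixP => x y; rewrite !mxE; congr (if _ then _ else _).
by apply/eqP/eqP => ->; rewrite inv.
Qed.

Lemma unitary_trmx p (U : 'M[C]_p) : unitary U -> unitary U^T.
Proof.
rewrite /unitary /conjT => /mulmx1C U1.
by rewrite map_trmx trmxK -[in map_mx _ U](trmxK (map_mx _ U)) -trmx_mul U1 trmx1.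
Qed.

(** Reverse the list and transpose each gate. This supplies the right factor of P E P^T. *)
Lemma circuit_trmx m (gs : seq (gate R)) : gates_ok m gs ->
  exists hs, [/\ gates_ok m hs, size hs = size gs & circuit_mx m hs = (circuit_mx m gs)^T].
Proof.
elim: gs => [|g gs IH] /=; first by exists [::]; split=> //; rewrite trmx1.
case=> ok_g /IH[hs [ok_hs sz_hs hsE]].
have [g' ok_g' g'E] : exists2 g', gate_ok m g' & gate_mx m g' = (gate_mx m g)^T.
  case: g ok_g => [c t|t U] ok_g.
    by exists (GCNOT R c t) => //=; rewrite trmx_cnot.
  case: ok_g => t_ok /unitary_trmx uU; exists (GSingle t U^T) => //.
  apply/matrixP => x y; rewrite /= !mxE.
  by rewrite [in RHS](eq_sym (y %/ _)%N) [in RHS](eq_sym (y %% _)%N).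
exists (hs ++ [:: g']); split; first by apply/gates_ok_cat.
  by rewrite size_cat /= addn1 sz_hs.
by rewrite circuit_mx_cat /= mulmx1 hsE g'E -trmx_mul.
Qed.

Lemma run_fanout n (r : seq nat) F : uniq r -> n \notin r ->
  run [seq GCNOT R n.+1 k.+1 | k <- r] F =
  fun x => F (fun k => if k \in r then x k (+) x n else x k).
Proof.
elim: r => [|k r IH] //; rewrite cons_uniq inE negb_or => /andP[kr uniq_r] /andP[nk nr].
rewrite map_cons run_cons IH // act_cnot; apply/funext => x; congr F; apply/funext => l.
rewrite inE (upd_neq _ _ _ _ nk) /upd.
by case: eqP => [->|_]; rewrite ?(negbTE kr).
Qed.

(* Maps [|0,k>] to [(|0,k> + |1,k>)/sqrt 2] and [|1,~k>] to [(|1,k> - |0,k>)/sqrt 2],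
   where [~k] is the bitwise complement [2^n - 1 - k]. *)
Definition folding (n : nat) : seq (gate R) :=
  [:: had_gate n, phase_gate n 0 1 & [seq GCNOT R n.+1 k.+1 | k <- iota 0 n]].

Lemma folding_ok n : gates_ok n.+1 (folding n).
Proof.
split; first exact: had_gate_ok.
split; first exact: phase_gate_ok.
have: all (ltn^~ n) (iota 0 n) by apply/allP => k; rewrite mem_iota.
elim: (iota 0 n) => //= k r IH /andP[lt_kn /IH ok_r]; split=> //=.
by split; lia.
Qed.

Lemma bitvalS n x : bitval n.+1 x = (bitval n x + x n * 2 ^ n)%N.
Proof. by rewrite /bitval big_ord_recr. Qed.

(** Complementing [n] bits is the mirror k -> 2^n - 1 - k, stated without subtraction. *)
Lemma bitvalC n x : (bitval n (fun k => ~~ x k) + (bitval n x).+1 = 2 ^ n)%N.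
Proof.
elim: n => [|n IH]; first by rewrite /bitval !big_ord0.
by rewrite !bitvalS expnS; case: (x n) => /=; lia.
Qed.

Lemma bitval_bits_mod n i : bitval n (bits i) = (i %% 2 ^ n)%N.
Proof.
have lt_r : (i %% 2 ^ n < 2 ^ n)%N by rewrite ltn_mod expn_gt0.
rewrite -[RHS](bitval_bits n) //; apply: eq_bigr => k _.
by rewrite {1}(divn_eq i (2 ^ n)) bits_cat // ltn_ord.
Qed.

(** The lower half of the rows takes differences and the upper half sums, because mirroring an index
    of E already brings a minus sign. *)
Lemma folding_mxE n p (A : 'M[C]_(2 ^ n.+1, p)) (j : 'I_p) (a : nat -> C) :
  (forall i, A i j = a i) ->
  forall i : 'I_(2 ^ n.+1), (circuit_mx n.+1 (folding n) *m A) i j =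
    rsqrt2 * (a (i %% 2 ^ n)%N +
              (-1) ^+ (i < 2 ^ n)%N * a (2 ^ n.+1 - (i %% 2 ^ n).+1)%N).
Proof.
move=> Aa i.
rewrite (@circuit_mx_run _ _ _ _ _ (fun x => a (bitval n.+1 x))); last 2 first.
- exact: folding_ok.
- by move=> k; rewrite Aa bitval_bits.
have lt_r : (i %% 2 ^ n < 2 ^ n)%N by rewrite ltn_mod expn_gt0.
have bit_n : bits i n = (2 ^ n <= i)%N.
  have lt_i : (i < 2 * 2 ^ n)%N by rewrite -expnS.
  rewrite /bits; case: leqP => [le_i|lt_i']; last by rewrite divn_small.
  have -> : (i : nat) = (1 * 2 ^ n + (i - 2 ^ n))%N by lia.
  by rewrite divnMDl ?expn_gt0 // divn_small //; lia.
rewrite /folding !run_cons run_fanout ?iota_uniq ?mem_iota ?ltnn ?andbF //.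
rewrite act_phase act_had big_bool.
(* With top bit 1 the CNOTs complement the lower bits of r = i mod 2^n, giving the mirror index
   2^(n+1) - 1 - r; with top bit 0 the index is r. *)
have val b : bitval n.+1 (fun k => if k \in iota 0 n then upd (bits i) n b k (+) upd (bits i) n b n
    else upd (bits i) n b k) = if b then (2 ^ n.+1 - (i %% 2 ^ n).+1)%N else (i %% 2 ^ n)%N.
  rewrite bitvalS mem_iota ltnn /= updd.
  have -> : bitval n (fun k => if k \in iota 0 n then upd (bits i) n b k (+) b
      else upd (bits i) n b k) = bitval n (fun k => bits i k (+) b).
    by apply: eq_bigr => k _; rewrite mem_iota /= ltn_ord upd_neq // neq_ltn ltn_ord.
  rewrite -!bitval_bits_mod; case: b => /=.
    have := bitvalC n (bits i).
    have -> : bitval n (fun k => bits i k (+) true) = bitval n (fun k => ~~ bits i k).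
      by apply: eq_bigr => k _; rewrite addbT.
    by have := expnS 2 n; lia.
  by rewrite addn0; apply: eq_bigr => k _; rewrite addbF.
rewrite !val !updd bit_n leqNgt andbT andbF oppr0 expipi0 expipi1.
by case: (_ < _)%N; rewrite /= ?oppr0 ?expipi0 ?expipiN1; ring.
Qed.

Lemma dft_phaseC m x y : dft_phase m x y = dft_phase m y x.
Proof. by rewrite /dft_phase; congr (_ / _); ring. Qed.

(* [theta(2^m - 1 - x, y) = 2 y + 1 - theta(x, y)], and [expipi] has period 2. *)
Lemma expipi_phase_mirror m x y : (x < 2 ^ m)%N ->
  expipi (- dft_phase m (2 ^ m - x.+1) y) = - expipi (dft_phase m x y).
Proof.
move=> lt_x; have -> : - dft_phase m (2 ^ m - x.+1) y =
    - y.*2%:R + (- 1 + dft_phase m x y).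
  rewrite /dft_phase natrB // natrX -addn1 natrD -muln2 natrM.
  by field; apply: exp2_neq0.
by rewrite !expipiD expipi_even expipiN1; ring.
Qed.

Lemma expipi_phase_mirrorN m x y : (x < 2 ^ m)%N ->
  expipi (dft_phase m (2 ^ m - x.+1) y) = - expipi (- dft_phase m x y).
Proof.
move=> lt_x; have {2}-> : x = (2 ^ m - (2 ^ m - x.+1).+1)%N by lia.
by rewrite expipi_phase_mirror ?opprK //; lia.
Qed.

Lemma expipiDN t : expipi t + expipi (- t) = 2 * (cos (pi * t))%:C.
Proof.
rewrite /expipi mulrN cosN sinN mulr_natl mulr2n.
by apply/eqP; rewrite eq_complex /= addr0 subrr !eqxx.
Qed.

Lemma expipiNB t : expipi (- t) - expipi t = 2 * (- 'i * (sin (pi * t))%:C).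
Proof.
rewrite /expipi mulrN cosN sinN mulr_natl mulr2n.
by apply/eqP; rewrite eq_complex /=; apply/andP; split; apply/eqP; ring.
Qed.

(** The factor L^(-1/2) with L = 2N, times the 2 of [expipiDN] and [expipiNB], is the type IV
    normalization. Both sides are nonnegative reals with the same square. *)
Lemma rsqrt2_exp n : rsqrt2 ^+ n.+1 * 2 = (Num.sqrt (2 / (2 ^ n)%:R))%:C.
Proof.
rewrite /rsqrt2 -rmorphXn /= -[2 : C](rmorph_nat (real_complex R)) -rmorphM /=; congr (_ %:C).
have h : 0 <= Num.sqrt (2^-1 : R) ^+ n.+1 * 2 by rewrite mulr_ge0 // exprn_ge0 // sqrtr_ge0.
rewrite -[LHS]ger0_norm // -sqrtr_sqr; congr Num.sqrt.
rewrite exprMn -exprM mulnC exprM sqr_sqrtr ?invr_ge0 // natrX exprVn exprS.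
by field; apply: exp2_neq0.
Qed.

(** As E is symmetric, E P^T = (P E)^T, so two uses of [folding_mxE] on rows compute P E P^T. *)
Lemma folded_dft n (hs : seq (gate R)) :
  circuit_mx n.+1 hs = (circuit_mx n.+1 (folding n))^T ->
  forall i j : 'I_(2 ^ n.+1),
  circuit_mx n.+1 (folding n ++ dft_circuit n.+1 ++ hs) i j =
  if (i < 2 ^ n)%N == (j < 2 ^ n)%N then
    let t := dft_phase n.+1 (i %% 2 ^ n) (j %% 2 ^ n) in
    rsqrt2 ^+ n.+1 *
    (if (i < 2 ^ n)%N then expipi t + expipi (- t) else expipi (- t) - expipi t)
  else 0.
Proof.
move=> hsE i j; rewrite circuit_mx_cat (circuit_mx_cat _ (dft_circuit _)) hsE.
set P := circuit_mx _ (folding n); set E := circuit_mx _ (dft_circuit _).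
have trE : E^T = E.
  by apply/matrixP => k l; rewrite mxE !dft_circuit_mxE // /dft_entry dft_phaseC.
have -> : E *m P^T = (P *m E)^T by rewrite [RHS]trmx_mul trE.
(* The entries of P E; column [j] of its transpose is [a j]. *)
pose a (l k : nat) := rsqrt2 * (dft_entry n.+1 (l %% 2 ^ n) k +
  (-1) ^+ (l < 2 ^ n)%N * dft_entry n.+1 (2 ^ n.+1 - (l %% 2 ^ n).+1) k).
rewrite (folding_mxE _ _ _ _ (a j)); last first.
  move=> k; rewrite mxE (folding_mxE _ _ _ _ (fun l => dft_entry n.+1 l k)) //.
  by move=> l; rewrite dft_circuit_mxE.
have lt_mod k : (k %% 2 ^ n < 2 ^ n.+1)%N.
  by apply: (@leq_trans (2 ^ n)); rewrite ?leq_exp2l // ltn_mod expn_gt0.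
rewrite /a /dft_entry !expipi_phase_mirror //.
rewrite ![dft_phase _ (j %% _) _]dft_phaseC expipi_phase_mirror // expipi_phase_mirrorN //.
set t := dft_phase _ _ _; set s := rsqrt2 ^+ n.+1.
have s2 : rsqrt2 * rsqrt2 = 2^-1 := rsqrt2_sqr.
have nz2 : (2 : C) != 0 by rewrite pnatr_eq0.
(* With u, v the signs of [i] and [j], the bracket is (1 + u v) exp(-i pi t) - (u + v) exp(i pi t):
   it vanishes when u and v differ, and otherwise its factor 2 cancels the two factors [rsqrt2]. *)
transitivity ((rsqrt2 * rsqrt2) * s * (expipi (- t) - (-1) ^+ (j < 2 ^ n)%N * expipi t +
   (-1) ^+ (i < 2 ^ n)%N * (- expipi t + (-1) ^+ (j < 2 ^ n)%N * expipi (- t)))).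
  by ring.
by rewrite s2; do 2![case: (_ < _)%N] => /=; field.
Qed.
End Circuits.

Theorem mainTheorem2 (R : realType) :
  exists (c : nat) (A : nat), (0 < c)%N /\
    forall n : nat, (1 <= n)%N ->
      exists (a : nat) (gs : seq (gate R)),
        [/\ (a <= A)%N,
            gates_ok (n.+1 + a) gs,
            (size gs <= c * n ^ 2)%N &
            realizes (circuit_mx (n.+1 + a) gs) (DCT4_DST4 R (2 ^ n))].
Proof.
(* The gate count is bounded by 3 + 1 + 26 + 6 = 36 at n = 1, where the quadratic estimate is
   tight. *)
exists 36%N, 0%N; split=> // n n_gt0; exists 0%N.
have [hs [hs_ok hs_size hsE]] := circuit_trmx R n.+1 _ (folding_ok R n).
exists (folding R n ++ dft_circuit R n.+1 ++ hs); rewrite addn0; split=> //.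
- apply/gates_ok_cat; split; first exact: folding_ok.
  by apply/gates_ok_cat; split=> //; apply: dft_circuit_ok.
- have folding_size : size (folding R n) = n.+2 by rewrite /= size_map size_iota.
  rewrite size_cat (size_cat (dft_circuit _ _)) hs_size folding_size.
  have := size_dft_circuit R n.+1.
  have : (n.+1./2 * 3 + 1 + n.+1 * (5 * n.+1 + 3) + (n.+2 + n.+2) <= 36 * n ^ 2)%N by nia.
  lia.
have eqN : (2 ^ n.+1 = 2 ^ n + 2 ^ n)%N by rewrite expnS mul2n addnn.
move=> i j _; rewrite folded_dft // /natmx.
have lt_i : (i < 2 ^ n + 2 ^ n)%N by rewrite -eqN.
have lt_j : (j < 2 ^ n + 2 ^ n)%N by rewrite -eqN.
rewrite !insubT /DCT4_DST4 block_mxEv mxE.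
(* The 2 in theta cancels against L = 2N and leaves the type IV angle with denominator N. *)
have phaseE (k l : nat) : pi * dft_phase R n.+1 k l =
    (k%:R + 2^-1) * (l%:R + 2^-1) * pi / (2 ^ n)%:R.
  rewrite /dft_phase natrX exprS; by field; apply: exp2_neq0.
case: splitP => i' /= def_i; rewrite mxE; case: splitP => j' /= def_j.
- rewrite mxE def_i def_j !ltn_ord eqxx /= expipiDN mulrA rsqrt2_exp.
  by rewrite !modn_small // phaseE -rmorphM.
- by rewrite mxE def_i def_j ltn_ord ltnNge leq_addr.
- by rewrite mxE def_i def_j ltn_ord ltnNge leq_addr.
rewrite !mxE def_i def_j !ltnNge !leq_addr /= !modnDl !modn_small // expipiNB phaseE.
by rewrite (mulrA (rsqrt2 R ^+ _)) rsqrt2_exp rmorphM /= mulrCA.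
Qed.
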